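(* Let $R_2^{(o)}(x,y,q)$ be the generating function of $r^2$-symmetric parallelogram polyominoes of odd width, where $x$, $y$, $q$ mark the width, the height and the area respectively. Then $$R_2^{(o)}(x,y,q)=\frac1x\,\mathbb{P}\!\left(\tfrac{1}{yq},x^2,y^2,q^2\right),$$ where $\mathbb{P}(v,x,y,q)$ is the generating function of all parallelogram polyominoes, the variables $v$, $x$, $y$, $q$ marking respectively the height of the rightmost column, the width, the overall height and the area.
   Context: A parallelogram polyomino is a finite nonempty connected set of unit cells of the square lattice, considered up to translation, whose intersection with every row and every column of cells is a contiguous block (or empty), and which contains the bottom-left and the top-right cells of its minimal bounding rectangle. Equivalently, with columns numbered $1,\dots,w$ from left to right, column $i$ occupies the rows $b_i,\dots,t_i$ with $b_i\le b_{i+1}\le t_i\le t_{i+1}$ for $1\le i<w$. Width and height are those of the minimal bounding rectangle; the area is the number of cells. Let $r^2$ denote the rotation by $180^\circ$; a polyomino is $r^2$-symmetric if it is equal, up to translation, to its image under $r^2$. Generating functions are formal power series in $q$ whose coefficients are polynomials in the other variables; the substitution $v=1/(yq)$ is performed termwise (it makes sense since the height of the rightmost column never exceeds the area). It is known (Bousquet-Mélou) that $\mathbb{P}(v,x,y,q)=vy\,\dfrac{J_1(v,x,y,q)}{J_0(x,y,q)}$ with $J_0(x,y,q)=\sum_{n\ge0}\frac{(-1)^nx^nq^{\binom{n+1}{2}}}{(q)_n(yq)_n}$ and $J_1(v,x,y,q)=\sum_{n\ge1}\frac{(-1)^{n-1}x^nq^{\binom{n+1}{2}}}{(q)_{n-1}(yq)_{n-1}(1-vyq^n)}$,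 where $(a)_n=\prod_{i=0}^{n-1}(1-aq^i)$. *)

(* Defs.v *)
From mathcomp Require Import all_boot all_order all_algebra.
From mathcomp Require Import mpoly.

Set Implicit Arguments.
Unset Strict Implicit.
Unset Printing Implicit Defensive.

Import GRing.Theory.
Local Open Scope ring_scope.

(* The cell (i, j) lies in column i (counted from the left) and row j (counted
   from the bottom).  A translation class of polyominoes is represented by its
   unique member whose bounding rectangle has (0, 0) as its bottom-left cell.
   A connected set of a cells has width and height at most a, so that this
   member fits in the a x a box whenever the area is a. *)
Notation cell n := ('I_n * 'I_n)%type.

Section Polyominoes.
Variable n : nat.
Implicit Types (c d e : cell n) (S : {set cell n}).

Definition adjacent c d : bool :=
  ((c.1 == d.1) && ((c.2.+1 == d.2 :> nat) || (d.2.+1 == c.2 :> nat)))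
  || ((c.2 == d.2) && ((c.1.+1 == d.1 :> nat) || (d.1.+1 == c.1 :> nat))).

Definition connected S : bool :=
  [forall c in S, forall d in S,
     connect [rel u w | [&& u \in S, w \in S & adjacent u w]] c d].

Definition row_convex S : bool :=
  [forall c in S, forall d in S, forall e : cell n,
     [&& e.2 == c.2, e.2 == d.2 & (c.1 <= e.1 <= d.1)%N] ==> (e \in S)].

Definition column_convex S : bool :=
  [forall c in S, forall d in S, forall e : cell n,
     [&& e.1 == c.1, e.1 == d.1 & (c.2 <= e.2 <= d.2)%N] ==> (e \in S)].

(* Dimensions of the bounding rectangle, for a set whose bounding rectangle has
   (0, 0) as its bottom-left cell. *)
Definition width S : nat := (\max_(c in S) c.1.+1)%N.
Definition height S : nat := (\max_(c in S) c.2.+1)%N.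

Definition last_column_height S : nat :=
  #|[set c in S | c.1.+1 == width S :> nat]|.

(* The third condition says at once that S is the chosen representative of its
   translation class and that S contains the bottom-left cell of its bounding
   rectangle. *)
Definition parallelogram S : bool :=
  [&& S != set0,
      connected S,
      [exists c in S, (c.1 == 0 :> nat)%N && (c.2 == 0 :> nat)%N],
      [exists c in S, (c.1.+1 == width S :> nat) && (c.2.+1 == height S :> nat)],
      row_convex S
    & column_convex S].

(* A rotation by 180 degrees followed by a translation is a point reflection
   (i, j) |-> (s - i, t - j); one that maps a nonempty subset of the box into
   the box has 0 <= s, t <= 2n - 2. *)
Definition r2_symmetric S : bool :=
  [exists s : 'I_n.*2, exists t : 'I_n.*2,
     [set c : cell n |
        [exists d in S, (c.1 + d.1 == s)%N && (c.2 + d.2 == t)%N]] == S].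

End Polyominoes.

(* A formal power series in q is given by its sequence of coefficients. *)

(* Coefficient of q^a in P(v, x, y, q): a polynomial in v, x, y, which are the
   variables of index 0, 1, 2. *)
Definition PP (a : nat) : {mpoly int[3]} :=
  \sum_(S : {set cell a} | parallelogram S && (#|S| == a))
    'X_(inord 0) ^+ last_column_height S
    * 'X_(inord 1) ^+ width S * 'X_(inord 2) ^+ height S.

(* Coefficient of q^a in R_2^(o)(x, y, q): a polynomial in x, y, which are the
   variables of index 0, 1. *)
Definition R2o (a : nat) : {mpoly int[2]} :=
  \sum_(S : {set cell a} | [&& parallelogram S, r2_symmetric S,
                               odd (width S) & #|S| == a])
    'X_(inord 0) ^+ width S * 'X_(inord 1) ^+ height S.

(* Z[x, y][q] and its field of fractions Q(x, y, q) *)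
Definition Zxyq : idomainType := {poly {mpoly int[2]}}.
Definition Qxyq : fieldType := {fraction Zxyq}.

Definition xx : Qxyq := tofrac (('X_(inord 0))%:P : Zxyq).
Definition yy : Qxyq := tofrac (('X_(inord 1))%:P : Zxyq).
Definition qq : Qxyq := tofrac ('X : Zxyq).

(* Sum of the terms of index a < M of F(v, x, y, q) = \sum_a F_a(v, x, y) q^a,
   each of them evaluated at the given values of v, x, y, q. *)
Definition partial_sum (F : nat -> {mpoly int[3]}) (v x y q : Qxyq) (M : nat) :
    Qxyq :=
  \sum_(a < M) mmap intr (tnth [tuple v; x; y]) (F a) * q ^+ a.

(* u_M tends to the power series \sum_k c_k q^k in Z[x, y][[q]]: for every N,
   u_M is eventually congruent to it modulo q^N. *)
Definition q_converges (u : nat -> Qxyq) (c : nat -> {mpoly int[2]}) : Prop :=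
  forall N : nat, exists M0 : nat, forall M : nat, (M0 <= M)%N ->
    exists2 p : Zxyq, u M = tofrac p & forall k : nat, (k < N)%N -> p`_k = c k.

(* Main.v *)
Require Import Defs.
From mathcomp Require Import all_boot all_order all_algebra.
From mathcomp Require Import mpoly zify ring.

Set Implicit Arguments.
Unset Strict Implicit.
Unset Printing Implicit Defensive.

(** A half-turn-symmetric polyomino of odd width 2w - 1 has a centre column, which
    the half-turn maps to itself; the polyomino is determined by its first w
    columns, which form an arbitrary parallelogram polyomino S ending with the
    centre column. Conversely, gluing S to its image under the half-turn about
    the centre of its last column yields such a symmetric polyomino. If S has
    width w, height h, area a and last column of height l, the glued polyomino
    has width 2w - 1, height 2h - l and area 2a - l, since the last column is
    shared by both halves. This is exactly the effect on the monomial
    v^l x^w y^h q^a of the substitution v = 1/(yq), x := x^2, y := y^2, q := q^2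
    followed by division by x ([glue_monomial]).

    A parallelogram polyomino is encoded by its profile, the list of the lowest
    and highest rows of its columns. [parallelogram_cells],
    [parallelogram_profile] and [cells_inj] show that the encoding is
    bijective, and [profile_enumeration] turns sums over sets of cells of a box
    into sums over lists of profiles. On profiles, the gluing [double] and its
    inverse [half_profile] are explicit ([doubleK], [halfK]), and the half-turn
    symmetry is an equation between opposite columns ([r2_symmetric_cells]).

    The height l of the last column is at most a, hence 2a - l >= a, and a
    coefficient of q^k of the substituted series only involves the terms of
    index a <= k: the partial sums are eventually constant modulo any power of
    q. *)

(** * Column profiles *)

Definition lo (s : seq (nat * nat)) (i : nat) : nat := (nth (0, 0) s i).1.
Definition hi (s : seq (nat * nat)) (i : nat) : nat := (nth (0, 0) s i).2.

(** These are the inequalities b_i <= b_(i+1) <= t_i <= t_(i+1) that characterise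
    parallelogram polyominoes, the lowest row of the first column being 0. *)
Definition profile (s : seq (nat * nat)) : Prop :=
  [/\ 0 < size s, lo s 0 = 0,
      forall i, i < size s -> lo s i <= hi s i
    & forall i, i.+1 < size s ->
        [/\ lo s i <= lo s i.+1, lo s i.+1 <= hi s i & hi s i <= hi s i.+1]].

Definition last_lo s := lo s (size s).-1.
Definition last_hi s := hi s (size s).-1.
Definition last_length s := (last_hi s - last_lo s).+1.
Definition area s := \sum_(i < size s) (hi s i - lo s i).+1.

(** As the upper rows increase, bounding the last one keeps the whole profile
    in the n x n box. *)
Definition fits n (s : seq (nat * nat)) : Prop := size s <= n /\ last_hi s < n.

Definition cells n s : {set cell n} :=
  [set c : cell n | (c.1 < size s) && (lo s c.1 <= c.2 <= hi s c.1)].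

Lemma lo_hi_eq s s' : size s = size s' ->
  (forall i, i < size s -> lo s i = lo s' i /\ hi s i = hi s' i) -> s = s'.
Proof.
move=> eq_sz eq_lh; apply: (@eq_from_nth _ (0, 0)) => // i /eq_lh[].
by rewrite /lo /hi; case: (nth _ s i) (nth _ s' i) => [? ?] [? ?] /= -> ->.
Qed.

Lemma profile_mono s i j : profile s -> i <= j -> j < size s ->
  lo s i <= lo s j /\ hi s i <= hi s j.
Proof.
case=> _ _ _ chain; elim: j => [|j IHj]; first by case: i.
rewrite leq_eqVlt => /predU1P[-> //|lt_ij] lt_j.
have [] := IHj lt_ij (ltnW lt_j); have [] := chain j lt_j; lia.
Qed.

Lemma profile_hi_last s i : profile s -> i < size s -> hi s i <= last_hi s.
Proof.
move=> Ps lt_i; have [] // := @profile_mono s i (size s).-1 Ps; lia.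
Qed.

Lemma last_length_le_area s : profile s -> last_length s <= area s.
Proof.
case=> s_gt0 _ _ _; have lt_m : (size s).-1 < size s by rewrite prednK.
by rewrite /area (bigD1 (Ordinal lt_m)) //= leq_addr.
Qed.

Lemma size_le_area s : size s <= area s.
Proof.
by rewrite -[X in X <= _]card_ord -sum1_card; apply: leq_sum.
Qed.

(** Consecutive columns overlap, so column i+1 reaches above the top of column i
    by less than its own length. *)
Lemma hi_lt_prefix_area s i : profile s -> i < size s ->
  hi s i < \sum_(0 <= k < i.+1) (hi s k - lo s k).+1.
Proof.
case=> _ lo0 _ chain; elim: i => [|i IHi] lt_i.
  by rewrite big_nat1 lo0 subn0.
rewrite big_nat_recr //=; have := IHi (ltnW lt_i); have [] := chain i lt_i; lia.
Qed.

(** This makes the choice of box immaterial: a profile of area n is realised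
    in the n x n box. *)
Lemma area_fits s : profile s -> fits (area s) s.
Proof.
move=> Ps; split; first exact: size_le_area.
have [s_gt0 _ _ _] := Ps.
have := @hi_lt_prefix_area s (size s).-1 Ps.
by rewrite prednK // big_mkord; apply.
Qed.

(** * From profiles to parallelogram polyominoes *)

Lemma cells_at n s i j : profile s -> fits n s -> i < size s ->
  lo s i <= j <= hi s i ->
  exists2 c : cell n, c \in cells n s & c.1 = i :> nat /\ c.2 = j :> nat.
Proof.
move=> Ps [sz_n hi_n] lt_i j_i; have hi_i := profile_hi_last Ps lt_i.
have lt_in : i < n by lia.
have lt_jn : j < n by lia.
by exists (Ordinal lt_in, Ordinal lt_jn); rewrite ?inE /= ?lt_i.
Qed.

Lemma cell_eq n (c d : cell n) :
  c.1 = d.1 :> nat -> c.2 = d.2 :> nat -> c = d.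
Proof. by case: c d => [? ?] [? ?] /= /val_inj-> /val_inj->. Qed.

Lemma width_cells n s : profile s -> fits n s -> width (cells n s) = size s.
Proof.
move=> Ps Fs; apply/eqP; rewrite eqn_leq; apply/andP; split.
  by apply/bigmax_leqP => c; rewrite inE => /andP[].
have [s_gt0 _ lohi _] := Ps; have lt_m : (size s).-1 < size s by rewrite prednK.
have [|c Sc [c1 _]] := @cells_at n s (size s).-1 (last_hi s) Ps Fs lt_m.
  by rewrite lohi /=.
by rewrite -(prednK s_gt0) -c1; apply: (leq_bigmax_cond c Sc).
Qed.

Lemma height_cells n s :
  profile s -> fits n s -> height (cells n s) = (last_hi s).+1.
Proof.
move=> Ps Fs; apply/eqP; rewrite eqn_leq; apply/andP; split.
  apply/bigmax_leqP => c; rewrite inE => /andP[lt_c /andP[_ c2]].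
  exact: leq_trans c2 (profile_hi_last Ps lt_c).
have [s_gt0 _ lohi _] := Ps; have lt_m : (size s).-1 < size s by rewrite prednK.
have [|c Sc [_ c2]] := @cells_at n s (size s).-1 (last_hi s) Ps Fs lt_m.
  by rewrite lohi /=.
by rewrite -c2; apply: (leq_bigmax_cond c Sc).
Qed.

Lemma card_columns n (P : pred nat) (f g : nat -> nat) :
  (forall i, P i -> f i <= g i < n) ->
  #|[set c : cell n | P c.1 && (f c.1 <= c.2 <= g c.1)]|
    = \sum_(i < n | P i) (g i - f i).+1.
Proof.
move=> fg; rewrite -sum1dep_card.
rewrite -(pair_big_dep (fun i : 'I_n => P i)
           (fun i j : 'I_n => f i <= j <= g i) (fun _ _ => 1)) /=.
apply: eq_bigr => i /fg /andP[le_fg lt_gn].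
rewrite -(big_mkord (fun j => f i <= j <= g i) (fun _ => 1)).
transitivity (\sum_(f i <= j < (g i).+1) 1); last first.
  by rewrite sum_nat_const_nat muln1 subSn.
by rewrite [RHS](big_nat_widenl _ 0) // [RHS](big_nat_widen _ _ n).
Qed.

Lemma card_cells n s : profile s -> fits n s -> #|cells n s| = area s.
Proof.
move=> Ps [sz_n hi_n]; rewrite /cells (@card_columns n (fun i => i < size s)).
  by rewrite /area (big_ord_widen n (fun i => (hi s i - lo s i).+1)).
move=> i lt_i; have [_ _ lohi _] := Ps.
by rewrite lohi //; apply: leq_ltn_trans (profile_hi_last Ps lt_i) hi_n.
Qed.

Lemma last_column_height_cells n s : profile s -> fits n s ->
  last_column_height (cells n s) = last_length s.
Proof.
move=> Ps Fs; have [s_gt0 _ lohi _] := Ps; have [sz_n hi_n] := Fs.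
rewrite /last_column_height width_cells //.
have -> : [set c in cells n s | c.1.+1 == size s]
        = [set c : cell n | (c.1.+1 == size s) && (lo s c.1 <= c.2 <= hi s c.1)].
  apply/setP => c; rewrite !inE andbC.
  by case: eqP => //= <-; rewrite ltnSn.
rewrite (@card_columns n (fun i => i.+1 == size s)); last first.
  move=> i /eqP sz_i; rewrite lohi -?sz_i //=.
  by move: hi_n; rewrite /last_hi -sz_i.
have lt_m : (size s).-1 < n by lia.
rewrite (big_pred1 (Ordinal lt_m)) // => i; rewrite /= -val_eqE /=; lia.
Qed.

Lemma cells_inj n s s' : profile s -> fits n s -> profile s' -> fits n s' ->
  cells n s = cells n s' -> s = s'.
Proof.
have sub r r' i : profile r -> fits n r -> profile r' -> fits n r' ->
    cells n r = cells n r' -> i < size r -> lo r' i <= lo r i /\ hi r i <= hi r' i.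
  move=> Pr Fr Pr' Fr' eq_rr' lt_i; have [_ _ lohi _] := Pr.
  have [|c + [ci cl]] := @cells_at n r i (lo r i) Pr Fr lt_i.
    by rewrite leqnn lohi.
  have [|d + [di dl]] := @cells_at n r i (hi r i) Pr Fr lt_i.
    by rewrite leqnn lohi.
  by rewrite eq_rr' !inE ci cl di dl; lia.
move=> Ps Fs Ps' Fs' eq_ss'.
have eq_sz : size s = size s'.
  by rewrite -(width_cells Ps Fs) eq_ss' width_cells.
apply: lo_hi_eq => // i lt_i.
have := sub s s' i Ps Fs Ps' Fs' eq_ss' lt_i.
have := sub s' s i Ps' Fs' Ps Fs (esym eq_ss'); rewrite -eq_sz => /(_ lt_i).
lia.
Qed.

(** Any cell reaches (0, 0) by going down its column to the lowest row, which is
    also met by the column to the left, then stepping left; the sum of the two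
    coordinates drops by one at each step. *)
Lemma connected_cells n s : profile s -> fits n s -> connected (cells n s).
Proof.
move=> Ps Fs; have [s_gt0 lo0 lohi chain] := Ps.
set S := cells n s; pose e := [rel u w | [&& u \in S, w \in S & adjacent u w]].
have [|o So [o1 o2]] := @cells_at n s 0 0 Ps Fs s_gt0; first by rewrite lo0.
have e_sym : connect_sym e.
  apply: sym_connect_sym => u w /=; rewrite andbCA /adjacent.
  by rewrite ![_ == u.1]eq_sym ![_ == u.2]eq_sym
     [X in _ && X || _]orbC [X in _ || _ && X]orbC.
have to_o k : forall c : cell n, c \in S -> c.1 + c.2 = k -> connect e c o.
  elim: k => [|k IHk] c Sc c_k.
    by rewrite (@cell_eq _ c o) ?connect0; lia.
  have [lt_c1 c2_col] : c.1 < size s /\ lo s c.1 <= c.2 <= hi s c.1.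
    by move: Sc; rewrite inE => /andP[].
  have step (d : cell n) : d \in S -> adjacent c d -> d.1 + d.2 = k -> connect e c o.
    move=> Sd adj d_k; apply: connect_trans (IHk d Sd d_k).
    by apply: connect1; rewrite /e /= Sc Sd.
  have [lt_lo|ge_lo] := ltnP (lo s c.1) c.2.
    have [|d Sd [d1 d2]] := @cells_at n s c.1 c.2.-1 Ps Fs lt_c1; first lia.
    apply: (step d) => //; last lia.
    by rewrite /adjacent -!val_eqE /=; lia.
  case def_i: (val c.1) => [|i].
    have lo_c : lo s c.1 = 0 by rewrite [X in lo s X]def_i.
    move: c_k; rewrite [X in X + _ = _]def_i; lia.
  have lt_i : i.+1 < size s by rewrite -def_i.
  have lo_c : lo s c.1 = lo s i.+1 by rewrite -def_i.
  have [le1 le2 le3] := chain i lt_i.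
  have [|d Sd [d1 d2]] := @cells_at n s i c.2 Ps Fs (ltnW lt_i); first lia.
  move: c_k; rewrite [X in X + _ = _]def_i => c_k.
  apply: (step d) => //; last lia.
  by rewrite /adjacent -!val_eqE /= def_i; lia.
apply/forall_inP => c Sc; apply/forall_inP => d Sd.
apply: connect_trans (to_o _ c Sc erefl) _.
by rewrite e_sym; apply: to_o Sd erefl.
Qed.

Lemma parallelogram_cells n s : profile s -> fits n s -> parallelogram (cells n s).
Proof.
move=> Ps Fs; have [s_gt0 lo0 lohi _] := Ps.
have lt_m : (size s).-1 < size s by rewrite prednK.
have [|o So [o1 o2]] := @cells_at n s 0 0 Ps Fs s_gt0; first by rewrite lo0.
have [|t St [t1 t2]] := @cells_at n s _ (last_hi s) Ps Fs lt_m.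
  by rewrite lohi /=.
apply/and5P; split; last (apply/andP; split).
- by apply/set0Pn; exists o.
- exact: connected_cells.
- by apply/exists_inP; exists o => //; rewrite o1 o2 !eqxx.
- apply/exists_inP; exists t => //.
  by rewrite width_cells // height_cells // t1 t2 prednK ?eqxx.
- apply/forall_inP => c Sc; apply/forall_inP => d Sd; apply/forallP => u.
  apply/implyP => /and3P[/eqP uc /eqP ud /andP[cu du]].
  move: Sc Sd; rewrite !inE -uc -ud => /andP[c1 c2] /andP[d1 d2].
  have lt_u := leq_ltn_trans du d1.
  have [_ hi_c] := profile_mono Ps cu lt_u.
  have [lo_d _] := profile_mono Ps du d1.
  case/andP: c2 d2 => _ c2 /andP[d2 _].
  by rewrite lt_u (leq_trans lo_d d2) (leq_trans c2 hi_c).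
- apply/forall_inP => c Sc; apply/forall_inP => d Sd; apply/forallP => u.
  apply/implyP => /and3P[/eqP uc /eqP ud /andP[cu du]].
  move: Sc Sd; rewrite !inE -uc -ud => /andP[-> /andP[c2 _]] /andP[_ /andP[_ d2]].
  by rewrite (leq_trans c2 cu) (leq_trans du d2).
Qed.

(** * From parallelogram polyominoes to profiles *)

Lemma connected_crossing n (S : {set cell n}) i (c d : cell n) :
  connected S -> c \in S -> d \in S -> c.1 <= i < d.1 ->
  exists u w : cell n, [/\ u \in S, w \in S, u.1 = i :> nat, w.1 = i.+1 :> nat
                & u.2 = w.2].
Proof.
move=> /forall_inP conS Sc Sd /andP[c_i i_d].
have /forall_inP/(_ d Sd)/connectP[p] := conS c Sc.
elim: p c Sc c_i => [|u p IHp] /= c Sc c_i /=; first by move=> _ def_d; subst d; lia.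
case/andP=> /and3P[_ Su adj] u_p def_d.
have [u_i|i_u] := leqP u.1 i; first exact: IHp u_p def_d.
exists c, u; case: c u adj Sc Su c_i i_u {IHp u_p def_d} => [c1 c2] [u1 u2].
rewrite /adjacent -!val_eqE /= => adj Sc Su c_i i_u.
by split=> //; try apply/val_inj; rewrite /=; lia.
Qed.

(** Membership with natural coordinates: coordinates outside the box need no
    bound proof and are just not occupied. *)
Definition occupied n (S : {set cell n}) i j :=
  [exists c in S, (c.1 == i :> nat) && (c.2 == j :> nat)].

Lemma occupiedP n (S : {set cell n}) i j :
  reflect (exists2 c, c \in S & c.1 = i :> nat /\ c.2 = j :> nat) (occupied S i j).
Proof.
apply: (iffP exists_inP) => [[c Sc /andP[/eqP ci /eqP cj]]|[c Sc [<- <-]]].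
  by exists c.
by exists c => //; rewrite !eqxx.
Qed.

Lemma occupied_cell n (S : {set cell n}) (c : cell n) : occupied S c.1 c.2 = (c \in S).
Proof.
apply/occupiedP/idP => [[d Sd [d1 d2]]|Sc]; last by exists c.
by rewrite -(cell_eq d1 d2).
Qed.

Lemma interval_pred n (P : pred nat) :
  (exists j, P j) -> (forall j, P j -> j < n) ->
  (forall j k l, P j -> P k -> j <= l <= k -> P l) ->
  exists p : nat * nat, forall j, P j = (p.1 <= j <= p.2).
Proof.
move=> exP boundP convP.
have leP j : P j -> j <= n by move/boundP/ltnW.
case: (ex_minnP exP) => a Pa minP; case: (ex_maxnP exP leP) => b Pb maxP.
exists (a, b) => j; apply/idP/idP => [Pj|]; first by rewrite minP ?maxP.
exact: convP.
Qed.

(** Convexity and connectedness make each column an interval which shares a row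
    with the next one; monotonicity is what the two corner cells give. If the
    lower end decreased from column i to column i+1, row lo (i+1) would meet no
    column up to i, by row convexity; columns 0 to i, each overlapping the
    next, would then all stay on the same side of that row, namely below it like
    the corner (0, 0), whereas column i lies above it. If the upper end
    decreased, row hi i would meet no column after i, and these columns would
    stay below it and never reach the top right corner. *)
Lemma parallelogram_profile n (S : {set cell n}) : parallelogram S ->
  exists s, [/\ profile s, fits n s & cells n s = S].
Proof.
case/and5P=> _ conS /exists_inP[o So /andP[/eqP o1 /eqP o2]].
case/exists_inP=> t St /andP[/eqP t1 /eqP t2] /andP[rowS colS].
have at0 : occupied S 0 0 by apply/occupiedP; exists o.
have bound (c : cell n) : c \in S -> c.1 < width S /\ c.2 < height S.
  by move=> Sc; split; apply: (@leq_bigmax_cond _ _ _ c Sc).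
have at_bound i j : occupied S i j ->
    [/\ i < n, j < n, i < width S & j < height S].
  by case/occupiedP=> c Sc [<- <-]; have [? ?] := bound c Sc; split=> //=.
have row_at i j k l : occupied S i j -> occupied S k j -> i <= l <= k -> occupied S l j.
  move=> /occupiedP[c Sc [ci cj]] /occupiedP[d Sd [dk dj]] ilk.
  have lt_ln : l < n by have := ltn_ord d.1; lia.
  have /forall_inP/(_ d Sd)/forallP/(_ (Ordinal lt_ln, c.2)) := forall_inP rowS c Sc.
  rewrite /= ci dk ilk eqxx -val_eqE /= cj dj eqxx /= => Sl.
  by apply/occupiedP; exists (Ordinal lt_ln, c.2).
have col_at i j k l : occupied S i j -> occupied S i k -> j <= l <= k -> occupied S i l.
  move=> /occupiedP[c Sc [ci cj]] /occupiedP[d Sd [di dk]] jlk.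
  have lt_ln : l < n by have := ltn_ord d.2; lia.
  have /forall_inP/(_ d Sd)/forallP/(_ (c.1, Ordinal lt_ln)) := forall_inP colS c Sc.
  rewrite /= cj dk jlk eqxx -val_eqE /= ci di eqxx /= => Sl.
  by apply/occupiedP; exists (c.1, Ordinal lt_ln).
have cross i : i.+1 < width S -> exists j, occupied S i j /\ occupied S i.+1 j.
  move=> lt_i; have [|u [w [Su Sw ui wi uw]]] :=
    @connected_crossing n S i o t conS So St; first by rewrite o1; rewrite -t1 in lt_i.
  by exists u.2; split; apply/occupiedP; [exists u | exists w] => //; rewrite -uw.
have at_top : occupied S (width S).-1 (height S).-1.
  by apply/occupiedP; exists t; rewrite // -t1 -t2.
have w_gt0 : 0 < width S by rewrite -t1.
have col_ne i : i < width S -> exists j, occupied S i j.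
  move=> lt_i; have [lt_i1|ge_i1] := ltnP i.+1 (width S).
    by have [j []] := cross i lt_i1; exists j.
  have -> : i = (width S).-1 by lia.
  by exists (height S).-1.
(* Overlapping columns that avoid row j and start below it remain below it. *)
have below i j k : (forall l, occupied S i l -> l < j) -> i <= k -> k < width S ->
    (forall m, i < m <= k -> ~~ occupied S m j) -> forall l, occupied S k l -> l < j.
  move=> base; elim: k => [|k IHk].
    by rewrite leqn0 => /eqP <-.
  rewrite leq_eqVlt => /predU1P[<- //|i_k] lt_k no_j l at_l.
  have {}IHk : forall l, occupied S k l -> l < j.
    by apply: IHk => // [|m m_k]; [exact: ltnW | apply: no_j; lia].
  have [r [at_r at_r1]] := cross k lt_k; have r_j := IHk r at_r.
  rewrite ltnNge; apply/negP => j_l.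
  have /negP[] := no_j k.+1 (introT andP (conj i_k (leqnn _))).
  by apply: (col_at _ r l); rewrite // (ltnW r_j).
have columns (i : 'I_(width S)) :
    exists p : nat * nat, forall j, occupied S i j = (p.1 <= j <= p.2).
  apply: (@interval_pred n) => [|j|j k l]; [exact: col_ne | by case/at_bound|].
  exact: col_at.
have {columns} [f f_at] := fin_all_exists columns.
pose s := [seq f i | i <- enum 'I_(width S)].
have sz_s : size s = width S by rewrite size_map size_enum_ord.
have s_at i j : i < width S -> occupied S i j = (lo s i <= j <= hi s i).
  move=> lt_i; rewrite /lo /hi (nth_map (Ordinal lt_i)) ?size_enum_ord //.
  by rewrite -{3 5}[i]/(nat_of_ord (Ordinal lt_i)) nth_ord_enum -f_at.
have lohi i : i < width S -> lo s i <= hi s i.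
  move=> lt_i; have [j] := col_ne i lt_i; rewrite s_at //; lia.
have Ps : profile s.
  split; rewrite ?sz_s //.
    by have := at0; rewrite s_at //; lia.
  move=> i lt_i1; have lt_i := ltnW lt_i1.
  have [j []] := cross i lt_i1; rewrite !s_at // => ij i1j.
  have lohi_i := lohi i lt_i; have lohi_i1 := lohi _ lt_i1.
  have le_lo : lo s i <= lo s i.+1.
    rewrite leqNgt; apply/negP => lt_lo.
    have at_i1 : occupied S i.+1 (lo s i.+1) by rewrite s_at // leqnn.
    have no_row m : m <= i -> ~~ occupied S m (lo s i.+1).
      move=> m_i; apply/negP => at_m.
      have: occupied S i (lo s i.+1) by apply: (row_at m _ i.+1); rewrite // m_i leqnSn.
      by rewrite s_at // [_ <= lo s i.+1]leqNgt lt_lo.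
    have base l : occupied S 0 l -> l < lo s i.+1.
      move=> at_l; rewrite ltnNge; apply/negP => ge_l.
      by have /negP[] := no_row 0 (leq0n _); apply: (col_at _ 0 l).
    have: lo s i < lo s i.+1.
      apply: (below 0 _ i base _ lt_i) => // [m /andP[_ /no_row] //|].
      by rewrite s_at // leqnn lohi_i.
    by rewrite ltnNge (ltnW lt_lo).
  have le_hi : hi s i <= hi s i.+1.
    rewrite leqNgt; apply/negP => lt_hi.
    have at_i : occupied S i (hi s i) by rewrite s_at // leqnn andbT.
    have no_row m : i < m -> ~~ occupied S m (hi s i).
      move=> i_m; apply/negP => at_m.
      have: occupied S i.+1 (hi s i) by apply: (row_at i _ m); rewrite // leqnSn.
      by rewrite s_at // [hi s i <= _]leqNgt lt_hi andbF.
    have base l : occupied S i.+1 l -> l < hi s i.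
      by rewrite s_at // => /andP[_ l_hi]; apply: leq_ltn_trans l_hi lt_hi.
    have [_ _ _ h_i] := at_bound _ _ at_i.
    have: (height S).-1 < hi s i.
      apply: (below i.+1 _ (width S).-1 base) at_top => [||m /andP[/ltnW]].
      - by rewrite -ltnS prednK.
      - by rewrite prednK.
      - by move/no_row.
    by rewrite ltnNge -ltnS (ltn_predK h_i) h_i.
  split=> //; lia.
exists s; split=> //.
  have [w_n h_n _ _] := at_bound _ _ at_top.
  split; first by rewrite sz_s; lia.
  rewrite /last_hi sz_s; have lt_m : (width S).-1 < width S by lia.
  have: occupied S (width S).-1 (hi s (width S).-1) by rewrite s_at // leqnn lohi.
  by case/at_bound.
apply/setP => c; rewrite inE sz_s -occupied_cell.
have [lt_c|ge_c] := ltnP c.1 (width S); first by rewrite s_at.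
by apply/esym/negbTE/negP => /at_bound[_ _]; rewrite ltnNge ge_c.
Qed.

(** The polyominoes of area n that satisfy Q become a duplicate-free list of
    profiles. The type of the list does not mention the box, so that polyominoes
    of different areas can be compared through such lists. *)
Lemma profile_enumeration n (Q : pred {set cell n}) :
  exists L : seq (seq (nat * nat)),
    [/\ uniq L,
        forall s, s \in L <-> [/\ profile s, area s = n & Q (cells n s)]
      & forall (V : nmodType) (F : {set cell n} -> V),
          (\sum_(S | [&& parallelogram S, Q S & #|S| == n]) F S
            = \sum_(s <- L) F (cells n s))%R].
Proof.
pose P := [pred S : {set cell n} | [&& parallelogram S, Q S & #|S| == n]].
have [f fP] : exists f : {set cell n} -> seq (nat * nat), forall S,
    parallelogram S -> [/\ profile (f S), fits n (f S) & cells n (f S) = S].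
  apply: (@fin_all_exists _ _ (fun S s =>
    parallelogram S -> [/\ profile s, fits n s & cells n s = S])) => S.
  have [/parallelogram_profile[s sP]|] := boolP (parallelogram S).
    by exists s.
  by exists [::].
exists [seq f A | A <- enum P]; split=> [|s|V F].
- rewrite map_inj_in_uniq ?enum_uniq // => S S'; rewrite !mem_enum.
  move=> /and3P[/fP[_ _ fS] _ _] /and3P[/fP[_ _ fS'] _ _] eq_f.
  by rewrite -fS eq_f fS'.
- split=> [/mapP[S]|[Ps area_s Qs]].
    rewrite mem_enum => /and3P[/fP[Pf Ff fS] QS /eqP cardS] ->.
    by rewrite -(card_cells Pf Ff) fS.
  have Fs : fits n s by rewrite -area_s; apply: area_fits.
  have parS := parallelogram_cells Ps Fs; have [Pf Ff fS] := fP _ parS.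
  rewrite (cells_inj Ps Fs Pf Ff (esym fS)) map_f // mem_enum inE.
  by rewrite parS Qs card_cells //; apply/eqP.
- rewrite big_map big_enum /=; apply: eq_bigr => S /and3P[/fP[_ _ ->]] //.
Qed.

(** * Half-turn symmetry of profiles *)

(** Invariance under (i, j) |-> (size s - 1 - i, last_hi s - j), which exchanges
    the lower end of each column with the upper end of the opposite one. *)
Definition self_dual s : Prop :=
  forall i, i < size s -> lo s ((size s).-1 - i) + hi s i = last_hi s.

(** A point reflection that preserves the polyomino must exchange its two corner
    cells, which leaves only one possible centre. *)
Lemma r2_symmetric_cells n s : profile s -> fits n s ->
  r2_symmetric (cells n s) <-> self_dual s.
Proof.
move=> Ps Fs; have [s_gt0 lo0 lohi _] := Ps; have [sz_n hi_n] := Fs.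
set m := (size s).-1; have lt_m : m < size s by rewrite prednK.
have hi_last i : i < size s -> hi s i <= last_hi s by apply: profile_hi_last.
split=> [/existsP[a /existsP[b /eqP symS]] i lt_i|dual_s].
  have sym_at j k : j < size s -> lo s j <= k <= hi s j ->
      exists u v, [/\ u < size s, lo s u <= v <= hi s u, j + u = a & k + v = b].
    move=> lt_j k_j; have [c Sc [<- <-]] := cells_at Ps Fs lt_j k_j.
    move: Sc; rewrite -symS inE => /exists_inP[d].
    rewrite inE => /andP[lt_d d_col] /andP[/eqP cd1 /eqP cd2].
    by exists d.1, d.2.
  have [|u0 [v0 [lt_u0 v0_col ua vb]]] := sym_at 0 0 s_gt0; first by rewrite lo0.
  have [|u1 [v1 [lt_u1 v1_col u1a v1b]]] := sym_at m (last_hi s) lt_m.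
    by rewrite lohi /=.
  have hi_u0 := hi_last _ lt_u0.
  have a_m : a = m :> nat by lia.
  have b_h : b = last_hi s :> nat by lia.
  have [|u [v [lt_u v_col ua' vb']]] := sym_at i (hi s i) lt_i.
    by rewrite lohi /=.
  have lt_mi : m - i < size s by lia.
  have [|u' [v' [lt_u' v_col' ua'' vb'']]] := sym_at (m - i) (lo s (m - i)) lt_mi.
    by rewrite lohi // leqnn.
  have def_u : u = m - i by lia.
  have def_u' : u' = i by lia.
  rewrite -/m; subst u u'; lia.
have lt_m2 : m < n.*2 by lia.
have lt_h2 : last_hi s < n.*2 by lia.
apply/existsP; exists (Ordinal lt_m2); apply/existsP; exists (Ordinal lt_h2).
apply/eqP/setP => -[[i lt_in] [j lt_jn]]; rewrite [LHS]inE.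
apply/exists_inP/idP => [[[[i' lt_in'] [j' lt_jn']]]|] /=.
  rewrite !inE /= => /andP[lt_i' j'_col] /andP[/eqP ii' /eqP jj'].
  have lt_i : i < size s by lia.
  have := dual_s i lt_i; have := dual_s i' lt_i'; rewrite -/m.
  have -> : m - i = i' by lia.
  have -> : m - i' = i by lia.
  have := hi_last _ lt_i; lia.
rewrite inE /= => /andP[lt_i j_col].
have lt_i' : m - i < size s by lia.
have := dual_s i lt_i; have := dual_s _ lt_i'; rewrite -/m.
have -> : m - (m - i) = i by lia.
move=> dual1 dual2; have hi_i := hi_last _ lt_i.
have [|d Sd [d1 d2]] := @cells_at n s (m - i) (last_hi s - j) Ps Fs lt_i'.
  lia.
by exists d => //; rewrite d1 d2; lia.
Qed.

(** * Gluing a polyomino to its half-turn along the last column *)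

(** The half-turn about the centre of the last column maps row j to row c - j and
    fixes that column, whose two copies are identified. *)
Definition double s :=
  let c := last_lo s + last_hi s in
  mkseq (fun i => if i < size s then nth (0, 0) s i else
                  let j := (size s).-1.*2 - i in (c - hi s j, c - lo s j))
    (size s).-1.*2.+1.

(** The first m + 1 columns when the width is 2m + 1, the centre included. *)
Definition half_profile (s : seq (nat * nat)) := take (size s)./2.+1 s.

Lemma size_double s : size (double s) = (size s).-1.*2.+1.
Proof. exact: size_mkseq. Qed.

Lemma double_left s i : i < size s ->
  lo (double s) i = lo s i /\ hi (double s) i = hi s i.
Proof. by move=> lt_i; rewrite /lo /hi !nth_mkseq ?lt_i //; lia. Qed.

(** The centre column is covered by [double_left] as well: both descriptions
    agree there. *)
Lemma double_right s i : 0 < size s -> (size s).-1 <= i <= (size s).-1.*2 ->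
  let c := last_lo s + last_hi s in
  lo (double s) i = c - hi s ((size s).-1.*2 - i) /\
  hi (double s) i = c - lo s ((size s).-1.*2 - i).
Proof.
move=> s_gt0 le_i c; have [lt_i|ge_i] := ltnP i (size s).
  have [-> ->] := double_left lt_i.
  have -> : (size s).-1.*2 - i = (size s).-1 by lia.
  have -> : i = (size s).-1 by lia.
  by rewrite /c addnK addKn.
by rewrite /lo /hi !nth_mkseq ?ltnNge ?ge_i //; lia.
Qed.

Lemma profile_double s : profile s -> profile (double s).
Proof.
move=> Ps; have [s_gt0 lo0 lohi chain] := Ps.
have hi_last i : i < size s -> hi s i <= last_hi s by apply: profile_hi_last.
split; rewrite ?size_double //; first by have [-> _] := double_left s_gt0.
  move=> i lt_i; have [lt_is|ge_is] := ltnP i (size s).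
    by have [-> ->] := double_left lt_is; apply: lohi.
  have [|-> ->] := @double_right s i s_gt0; first lia.
  by apply/leq_sub2l/lohi; lia.
move=> i lt_i; have [lt_is|ge_is] := ltnP i.+1 (size s).
  have [-> ->] := double_left lt_is; have [-> ->] := double_left (ltnW lt_is).
  exact: chain.
have [|-> ->] := @double_right s i s_gt0; first lia.
have [|-> ->] := @double_right s i.+1 s_gt0; first lia.
set j := _ - i.+1; have -> : (size s).-1.*2 - i = j.+1 by rewrite /j; lia.
have lt_j : j.+1 < size s by rewrite /j; lia.
have [ch1 ch2 ch3] := chain j lt_j; split; exact: leq_sub2l.
Qed.

Lemma last_hi_double s : profile s ->
  last_hi (double s) = last_lo s + last_hi s.
Proof.
case=> s_gt0 lo0 _ _; rewrite /last_hi size_double /=.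
by have [|_ ->] := @double_right s (size s).-1.*2 s_gt0;
   rewrite ?subnn ?lo0 ?subn0 //; lia.
Qed.

Lemma self_dual_double s : profile s -> self_dual (double s).
Proof.
move=> Ps; have [s_gt0 lo0 lohi chain] := Ps => i.
have hi_last j : j < size s -> hi s j <= last_hi s by apply: profile_hi_last.
rewrite last_hi_double // size_double /= => lt_i.
have [lt_is|ge_is] := ltnP i (size s).
  have [_ ->] := double_left lt_is.
  have [|-> _] := @double_right s ((size s).-1.*2 - i) s_gt0; first lia.
  have -> : (size s).-1.*2 - ((size s).-1.*2 - i) = i by lia.
  have := hi_last i lt_is; lia.
have [|_ ->] := @double_right s i s_gt0; first lia.
have lt_j : (size s).-1.*2 - i < size s by lia.
have [-> _] := double_left lt_j.
have := hi_last _ lt_j; have := lohi _ lt_j; lia.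
Qed.

(** The columns up to the centre and the columns from the centre on have the same
    total area, and the centre is counted in both. *)
Lemma area_double s : profile s ->
  area (double s) + last_length s = (area s).*2.
Proof.
move=> Ps; have [s_gt0 lo0 lohi chain] := Ps.
have hi_last j : j < size s -> hi s j <= last_hi s by apply: profile_hi_last.
rewrite /area size_double -(big_mkord xpredT (fun i => (hi s i - lo s i).+1)).
rewrite -(big_mkord xpredT (fun i => (hi (double s) i - lo (double s) i).+1)).
set m := (size s).-1; have sz_s : size s = m.+1 by rewrite prednK.
pose g i := (hi (double s) i - lo (double s) i).+1.
have left_sum : \sum_(0 <= i < m.+1) g i = \sum_(0 <= i < m.+1) (hi s i - lo s i).+1.
  apply: eq_big_nat => i /andP[_]; rewrite -sz_s /g => lt_i.
  by have [-> ->] := double_left lt_i.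
have right_sum : \sum_(m <= i < m.*2.+1) g i
    = \sum_(0 <= i < m.+1) (hi s i - lo s i).+1.
  rewrite -[m in LHS]add0n big_addn big_nat_rev.
  have -> : m.*2.+1 - m = m.+1 by lia.
  apply: eq_big_nat => i /andP[_ lt_i]; rewrite /g.
  have lt_is : i < size s by rewrite sz_s.
  have [|-> ->] := @double_right s (0 + m.+1 - i.+1 + m) s_gt0; first lia.
  have -> : (size s).-1.*2 - (0 + m.+1 - i.+1 + m) = i by lia.
  have := hi_last i lt_is; have := lohi i lt_is; lia.
have gm : g m = last_length s.
  by rewrite /g; have [|-> ->] := @double_left s m; rewrite ?sz_s.
have cat : \sum_(0 <= i < m.*2.+1) g i
    = \sum_(0 <= i < m.+1) g i + \sum_(m.+1 <= i < m.*2.+1) g i.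
  by apply: big_cat_nat; lia.
have rec : \sum_(m <= i < m.*2.+1) g i = g m + \sum_(m.+1 <= i < m.*2.+1) g i.
  by apply: big_ltn; lia.
rewrite -[X in X + _ = _]/(\sum_(0 <= i < m.*2.+1) g i) sz_s -left_sum cat -gm.
move: right_sum; rewrite rec -left_sum; lia.
Qed.

Lemma doubleK s : 0 < size s -> half_profile (double s) = s.
Proof.
move=> s_gt0; rewrite /half_profile size_double.
have -> : (size s).-1.*2.+1./2.+1 = size s by lia.
have sz : size (take (size s) (double s)) = size s.
  by rewrite size_takel ?size_double //; lia.
apply: lo_hi_eq => // i; rewrite sz => lt_i.
by have [<- <-] := double_left lt_i; rewrite /lo /hi nth_take.
Qed.

Lemma size_half s : odd (size s) -> size (half_profile s) = (size s)./2.+1.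
Proof. by move=> odd_s; rewrite size_takel //; lia. Qed.

Lemma half_left s i : i <= (size s)./2 ->
  lo (half_profile s) i = lo s i /\ hi (half_profile s) i = hi s i.
Proof. by move=> le_i; rewrite /lo /hi nth_take. Qed.

Lemma profile_half s : odd (size s) -> profile s -> profile (half_profile s).
Proof.
move=> odd_s [s_gt0 lo0 lohi chain]; split; rewrite ?size_half //.
- by have [-> _] := @half_left s 0 (leq0n _).
- by move=> i lt_i; have [-> ->] := @half_left s i lt_i; apply: lohi; lia.
- move=> i lt_i; have [-> ->] := @half_left s i.+1 lt_i.
  by have [-> ->] := @half_left s i (ltnW lt_i); apply: chain; lia.
Qed.

Lemma halfK s : odd (size s) -> profile s -> self_dual s ->
  double (half_profile s) = s.
Proof.
move=> odd_s Ps dual_s; have sz_h := size_half odd_s.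
set h := half_profile s in sz_h *; set m := (size s)./2 in sz_h.
have sz_s : size s = m.*2.+1 by rewrite /m; lia.
have [lo_m hi_m] : lo h m = lo s m /\ hi h m = hi s m by apply: half_left.
have center : lo s m + hi s m = last_hi s.
  have lt_m : m < size s by lia.
  by rewrite -(dual_s m lt_m) sz_s /= -addnn addKn.
apply: lo_hi_eq; rewrite size_double sz_h //= => i lt_i.
have [le_i|gt_i] := leqP i m.
  have [|-> ->] := @double_left h i; first by rewrite sz_h.
  exact: half_left.
have [||-> ->] := @double_right h i; rewrite ?sz_h //=; first lia.
rewrite /last_lo /last_hi sz_h /= lo_m hi_m center.
have le_j : m.*2 - i <= m by lia.
have [-> ->] := half_left le_j.
have lt_is : i < size s by lia.
have lt_js : m.*2 - i < size s by lia.
have := dual_s _ lt_is; have := dual_s _ lt_js; rewrite sz_s /=.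
have -> : m.*2 - (m.*2 - i) = i by lia.
lia.
Qed.

(** * Comparison of the generating functions *)

(** The bijection in terms of generating functions: symmetric polyominoes of odd
    width and area k are sorted by the area a of their left half, and those with
    a given a are the doubles of the polyominoes of area a whose last column has
    height 2a - k. As a <= k, only the indices a < M occur. *)
Lemma sum_odd_symmetric (V : nmodType) (F : nat -> nat -> V) k M : k < M ->
  (\sum_(T : {set cell k} |
       [&& parallelogram T, r2_symmetric T && odd (width T) & #|T| == k])
      F (width T) (height T)
   = \sum_(a < M) \sum_(S : {set cell a} |
       [&& parallelogram S, (a.*2 - last_column_height S == k)%N & #|S| == a])
      F (width S).*2.-1 ((height S).*2 - last_column_height S)%N)%R.
Proof.
move=> lt_kM.
have [L [uniqL memL ->]] := profile_enumeration
  [pred T : {set cell k} | r2_symmetric T && odd (width T)].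
have {}memL t : t \in L <->
    [/\ profile t, area t = k, self_dual t & odd (size t)].
  split=> [/memL[Pt area_t /andP[]]|[Pt area_t dual_t odd_t]].
    have Ft : fits k t by rewrite -area_t; apply: area_fits.
    by rewrite width_cells // => /(r2_symmetric_cells Pt Ft).
  have Ft : fits k t by rewrite -area_t; apply: area_fits.
  apply/memL; split=> //=; rewrite width_cells // odd_t andbT.
  exact/(r2_symmetric_cells Pt Ft).
have half_area t : t \in L -> area (half_profile t) < M.
  case/memL=> Pt area_t dual_t odd_t; have Ph := profile_half odd_t Pt.
  have := area_double Ph; have := last_length_le_area Ph.
  rewrite halfK // area_t; lia.
transitivity (\sum_(t <- L) \sum_(a < M | area (half_profile t) == a)
    F (size t) (last_hi t).+1)%R.
  apply: eq_big_seq => t tL; rewrite (big_pred1 (Ordinal (half_area t tL))).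
    case/memL: tL => Pt area_t _ _.
    have Ft : fits k t by rewrite -area_t; apply: area_fits.
    by rewrite width_cells // height_cells.
  by move=> a; rewrite /= -val_eqE eq_sym.
rewrite (exchange_big_dep xpredT) //=; apply: eq_bigr => -[a lt_a] _ /=.
have [L' [uniqL' memL' ->]] := profile_enumeration
  [pred S : {set cell a} | a.*2 - last_column_height S == k].
have {}memL' s : s \in L' <->
    [/\ profile s, area s = a & a.*2 - last_length s = k].
  split=> [/memL'[Ps area_s /eqP]|[Ps area_s k_s]].
    have Fs : fits a s by rewrite -area_s; apply: area_fits.
    by rewrite last_column_height_cells.
  have Fs : fits a s by rewrite -area_s; apply: area_fits.
  by apply/memL'; split=> //=; rewrite last_column_height_cells // k_s.
transitivity (\sum_(t <- [seq double s | s <- L']) F (size t) (last_hi t).+1)%R.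
  rewrite -big_filter; apply/perm_big/uniq_perm.
  - exact: filter_uniq.
  - rewrite map_inj_in_uniq // => s s' /memL'[[s_gt0 _ _ _] _ _].
    by move=> /memL'[[s'_gt0 _ _ _] _ _] eq_d; rewrite -(doubleK s_gt0) eq_d doubleK.
  move=> t; rewrite mem_filter; apply/andP/mapP => [[/eqP area_h]|[s sL' ->]].
    case/memL=> Pt area_t dual_t odd_t; have Ph := profile_half odd_t Pt.
    exists (half_profile t); last by rewrite halfK.
    apply/memL'; split=> //; have := area_double Ph; rewrite halfK // area_t area_h.
    by move<-; rewrite addnK.
  case/memL': sL' => Ps area_s k_s; have [s_gt0 _ _ _] := Ps.
  split; first by rewrite doubleK ?area_s.
  apply/memL; split; [exact: profile_double | | exact: self_dual_double |].
    by rewrite -k_s -area_s -area_double // addnK.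
  by rewrite size_double /= odd_double.
rewrite big_map; apply: eq_big_seq => s /memL'[Ps area_s k_s].
have Fs : fits a s by rewrite -area_s; apply: area_fits.
have [s_gt0 _ lohi _] := Ps.
have lt_m : (size s).-1 < size s by rewrite prednK.
rewrite width_cells // height_cells // last_column_height_cells //.
rewrite size_double last_hi_double //; congr F; first lia.
have := lohi _ lt_m; rewrite -/(last_lo s) -/(last_hi s) /last_length; lia.
Qed.

Lemma parallelogram_bounds n (S : {set cell n}) : parallelogram S ->
  [/\ 0 < width S, last_column_height S <= height S
    & last_column_height S <= #|S|].
Proof.
case/parallelogram_profile=> s [Ps Fs <-]; have [s_gt0 _ _ _] := Ps.
rewrite width_cells // height_cells // last_column_height_cells // card_cells //.
by split=> //; [rewrite /last_length ltnS leq_subr | apply: last_length_le_area].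
Qed.

Import GRing.Theory.
Local Open Scope ring_scope.

(** Under v = 1/(yq), x := x^2, y := y^2, q := q^2 and after division by x, the
    monomial of a polyomino becomes the monomial of its double. The bounds on l
    are those that keep the exponents non-negative. *)
Lemma glue_monomial (K : fieldType) (x y q : K) l w h a :
  x != 0 -> y != 0 -> q != 0 ->
  (0 < w)%N -> (l <= h.*2)%N -> (l <= a.*2)%N ->
  x^-1 * ((y * q)^-1 ^+ l * (x ^+ 2) ^+ w * (y ^+ 2) ^+ h * (q ^+ 2) ^+ a)
    = x ^+ w.*2.-1 * y ^+ (h.*2 - l) * q ^+ (a.*2 - l).
Proof.
move=> x0 y0 q0 w_gt0 l_h l_a; rewrite -!exprM !mul2n.
rewrite -{1}(subnK l_h) -{1}(subnK l_a) !exprD.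
have -> : (w.*2 = w.*2.-1.+1)%N by lia.
rewrite exprVn exprMn exprS /=; field.
by rewrite x0 !expf_neq0.
Qed.

Theorem proposition5 :
  q_converges
    (fun M : nat =>
       xx^-1 * partial_sum PP (yy * qq)^-1 (xx ^+ 2) (yy ^+ 2) (qq ^+ 2) M)
    R2o.
Proof.
move=> N; exists N => M le_NM.
pose mon (w h : nat) : {mpoly int[2]} := 'X_(inord 0) ^+ w * 'X_(inord 1) ^+ h.
pose p : Zxyq := \sum_(a < M) \sum_(S : {set cell a} | parallelogram S && (#|S| == a))
  (mon (width S).*2.-1 ((height S).*2 - last_column_height S)%N)%:P
    * 'X^(a.*2 - last_column_height S).
have X_neq0 (i : 'I_2) : 'X_i != 0 :> {mpoly int[2]}.
  by rewrite -msupp_eq0 msuppX.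
have x0 : xx != 0 by rewrite /xx tofrac_eq0 polyC_eq0.
have y0 : yy != 0 by rewrite /yy tofrac_eq0 polyC_eq0.
have q0 : qq != 0 by rewrite /qq tofrac_eq0 polyX_eq0.
exists p => [|k lt_kN].
  rewrite /partial_sum /p mulr_sumr rmorph_sum; apply: eq_bigr => a _ /=.
  rewrite /PP !rmorph_sum mulr_suml mulr_sumr; apply: eq_bigr => S /=.
  case/andP=> /parallelogram_bounds[w_gt0 l_h l_a] /eqP card_S.
  rewrite card_S in l_a.
  have l_h2 : (last_column_height S <= (height S).*2)%N.
    by rewrite (leq_trans l_h) // -addnn leq_addr.
  have l_a2 : (last_column_height S <= a.*2)%N.
    by rewrite (leq_trans l_a) // -addnn leq_addr.
  rewrite !rmorphM !rmorphXn /= !mmapX !mmap1U !(tnth_nth 0) !inordK //=.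
  by rewrite glue_monomial.
transitivity (\sum_(a < M) \sum_(S : {set cell a} |
       [&& parallelogram S, (a.*2 - last_column_height S)%N == k & #|S| == a])
      mon (width S).*2.-1 ((height S).*2 - last_column_height S)%N).
  rewrite coef_sum; apply: eq_bigr => a _; rewrite coef_sum.
  rewrite [RHS](eq_bigl (fun S : {set cell a} => (parallelogram S && (#|S| == a))
     && ((a.*2 - last_column_height S)%N == k))); last first.
    by move=> S; rewrite andbCA andbC -andbA [X in _ && X]andbC.
  rewrite [RHS]big_mkcondr; apply: eq_bigr => S _.
  rewrite coefCM coefXn eq_sym; case: eqP => _; by rewrite ?mulr1 ?mulr0.
rewrite -sum_odd_symmetric ?(leq_trans lt_kN) // /R2o.
by apply: eq_bigl => T; rewrite -!andbA.
Qed.
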